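(* Let $d\ge 12$. Every connected triangle-free graph in which every vertex has degree at least $d$ is well-burnable, i.e. if it has $n$ vertices then its burning number is at most $\lceil\sqrt n\,\rceil$.
   Context: Graphs are finite, simple, undirected. Triangle-free means no 3-cycles. Burning process on a graph $G$: in round 1 one vertex is chosen and set on fire; in each subsequent round, first every burning vertex sets all its neighbours on fire, then one new vertex is chosen and set on fire; the process ends when all vertices are on fire. The burning number $b(G)$ is the minimum number of rounds needed. A graph on $n$ vertices is well-burnable if $b(G)\le\lceil\sqrt n\,\rceil$. *)

(* Defs.v *)
From mathcomp Require Import all_boot all_order all_algebra.
From mathcomp Require Import reals.

Set Implicit Arguments.
Unset Strict Implicit.
Unset Printing Implicit Defensive.

Section Graph.
Variables (T : finType) (e : rel T).

Definition degree (x : T) : nat := #|[set y | e x y]|.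

Definition graph_connected : Prop := forall x y : T, connect e x y.

(* For irreflexive e, such x, y, z are automatically distinct. *)
Definition triangle_free : Prop :=
  forall x y z : T, ~ [/\ e x y, e y z & e z x].

Definition spread (B : {set T}) : {set T} :=
  B :|: [set y | [exists x in B, e x y]].

(* Starting from the burning set B, s lists the vertices chosen in successive
   rounds. A round takes place only while some vertex is not burning; the
   vertex chosen must not have been reached by the fire, unless the spreading
   step of that round has left no such vertex. *)
Fixpoint burning_run (B : {set T}) (s : seq T) : bool :=
  if s is v :: s' then
    [&& B != setT, (v \notin spread B) || (spread B == setT)
      & burning_run (v |: spread B) s']
  else true.

Fixpoint burnt (B : {set T}) (s : seq T) : {set T} :=
  if s is v :: s' then burnt (v |: spread B) s' else B.

(* Starting from set0 makes the first round consist of a choice only, as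
   spread set0 = set0. *)
Definition burnable_in (k : nat) : bool :=
  [exists s : k.-tuple T, burning_run set0 s && (burnt set0 s == setT)].

Lemma burning_run_ends (B : {set T}) :
  exists s, burning_run B s && (burnt B s == setT).
Proof.
have [n] := ubnP #|~: B|; elim: n B => // n IHn B ltBn.
have [->|nBT] := eqVneq B setT; first by exists [::] => /=; rewrite eqxx.
have [v vP] : exists v, [&& (v \notin spread B) || (spread B == setT)
                          & (~: (v |: spread B)) \proper ~: B].
  have sBB : B \subset spread B by rewrite subsetUl.
  have [x xNB] : exists x, x \notin B.
    apply/existsP; rewrite -negb_forall; apply: contra nBT => /forallP allB.
    by apply/eqP/setP => x; rewrite in_setT allB.
  have [sT|] := eqVneq (spread B) setT.
    exists x; rewrite orbT /= sT setUT setCT proper0.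
    by apply/set0Pn; exists x; rewrite inE.
  move=> nsT; have [y yN] : exists y, y \notin spread B.
    apply/existsP; rewrite -negb_forall; apply: contra nsT => /forallP allB.
    by apply/eqP/setP => y; rewrite in_setT allB.
  exists y; rewrite yN /= properC.
  apply/properP; split; first exact: subset_trans sBB (subsetUr _ _).
  by exists y; [rewrite setU11 | apply: contra yN; apply: (subsetP sBB)].
case/andP: vP => vP /proper_card ltv.
have [s sP] := IHn _ (leq_trans ltv ltBn).
by exists (v :: s); rewrite /= nBT vP.
Qed.

Lemma burnable_exists : exists k, burnable_in k.
Proof.
have [s sP] := burning_run_ends set0.
by exists (size s); apply/existsP; exists (in_tuple s).
Qed.

Definition burning_number : nat := ex_minn burnable_exists.

Definition well_burnable (R : realType) : Prop :=
  (burning_number%:Z <= Num.ceil (Num.sqrt (#|T|%:R : R)))%R.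

End Graph.

(* Main.v *)
(** Grow a set [A] of centres, each new one at distance exactly 3 from the
    previous ones, until every vertex is within distance 2 of [A].  The closed
    neighbourhoods of the centres are disjoint, so [13 * #|A| <= n], and linking
    each centre to an earlier one at distance 3 makes [A] a rooted tree.  A ball
    of radius [r = 3 * s + 2] or more around the [s]-th ancestor of a deepest
    remaining centre covers the cells of a whole subtree with at least [s.+1]
    centres (or of all remaining centres).  The balls of radius [0, ..., k.-1]
    thus handle [\sum_(r < k) r.+1 %/ 3], about [k ^ 2 / 6], centres, which
    exceeds [k ^ 2 / 13]. *)
Require Import Defs.
From mathcomp Require Import all_boot all_order all_algebra.
From mathcomp Require Import reals.
From mathcomp Require Import zify.

Set Implicit Arguments.
Unset Strict Implicit.
Unset Printing Implicit Defensive.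

Import Order.TTheory GRing.Theory Num.Theory.

Section Burning.
Variables (T : finType) (e : rel T).
Implicit Types (A B C U D : {set T}) (x y z v : T) (s : seq T) (p : T -> T).

Local Notation spread := (spread e).

(** * Spreading of the fire *)

Lemma in_spread B y : (y \in spread B) = (y \in B) || [exists x in B, e x y].
Proof. by rewrite !inE. Qed.

Lemma spreadS B C : B \subset C -> spread B \subset spread C.
Proof.
move=> sBC; apply/subsetP => y; rewrite !in_spread => /orP[/(subsetP sBC)->//|].
case/existsP=> x /andP[xB exy]; apply/orP; right; apply/existsP; exists x.
by rewrite (subsetP sBC).
Qed.

Lemma sub_spread B : B \subset spread B.
Proof. exact: subsetUl. Qed.

Lemma spreadU B C : spread (B :|: C) = spread B :|: spread C.
Proof.
apply/eqP; rewrite eqEsubset subUset.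
rewrite !spreadS ?subsetUl ?subsetUr ?andbT //.
apply/subsetP => y; rewrite in_setU !in_spread in_setU.
case/orP=> [/orP[]->|]; rewrite ?orbT //.
case/existsP=> x /andP[/setUP[]xBC exy]; apply/orP; [left|right];
  by apply/orP; right; apply/existsP; exists x; rewrite xBC.
Qed.

Lemma iter_spreadS k B C :
  B \subset C -> iter k spread B \subset iter k spread C.
Proof. by move=> sBC; elim: k => //= k; apply: spreadS. Qed.

Lemma iter_spreadU k B C :
  iter k spread (B :|: C) = iter k spread B :|: iter k spread C.
Proof. by elim: k => //= k ->; apply: spreadU. Qed.

Lemma iter_spread_leq j k B :
  j <= k -> iter j spread B \subset iter k spread B.
Proof.
move/subnKC <-; elim: (k - j) => [|i IH]; first by rewrite addn0.
by rewrite addnS iterS (subset_trans IH) ?sub_spread.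
Qed.

Lemma in_iter_spread k A x :
  (x \in iter k spread A) -> exists2 a, a \in A & x \in iter k spread [set a].
Proof.
elim: k x => [|k IH] x /=; first by exists x => //; rewrite set11.
rewrite in_spread => /orP[/IH[a aA xa]|/existsP[y /andP[/IH[a aA ya] eyx]]].
  by exists a => //; apply: (subsetP (sub_spread _)).
exists a => //; rewrite in_spread; apply/orP; right; apply/existsP; exists y.
by rewrite ya.
Qed.

Lemma iter_spread0 k : iter k spread set0 = set0.
Proof.
apply/setP=> x; rewrite in_set0; apply/negP => /in_iter_spread[a].
by rewrite in_set0.
Qed.

Lemma spread1_sym x y :
  symmetric e -> (x \in spread [set y]) = (y \in spread [set x]).
Proof.
have spread1E u v : (u \in spread [set v]) = (u == v) || e v u.
  rewrite in_spread inE; congr (_ || _); apply/existsP/idP => [[w]|evu].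
    by rewrite inE => /andP[/eqP->].
  by exists v; rewrite set11.
by move=> e_sym; rewrite !spread1E eq_sym e_sym.
Qed.

Lemma card_spread1 x : irreflexive e -> #|spread [set x]| = (degree e x).+1.
Proof.
move=> e_irr; have -> : spread [set x] = x |: [set y | e x y].
  apply/setP=> y; rewrite in_spread !inE; congr (_ || _).
  apply/existsP/idP => [[w]|exy]; first by rewrite inE => /andP[/eqP->].
  by exists x; rewrite set11.
by rewrite cardsU1 inE e_irr.
Qed.

Lemma spread_closed B x :
  graph_connected e -> x \in B -> spread B \subset B -> B = setT.
Proof.
move=> e_conn xB clB; apply/setP=> y; rewrite in_setT.
case/connectP: (e_conn x y) => q; elim: q x xB => [x xB _ ->//|z q IH x xB /=].
case/andP=> exz; apply: IH; apply: (subsetP clB); rewrite in_spread.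
by apply/orP; right; apply/existsP; exists x; rewrite xB.
Qed.

(** * Choice sequences and the burning number *)

Lemma burnt_cover B s : iter (size s) spread B \subset burnt e B s.
Proof.
elim: s B => //= v s IH B; rewrite -iterS iterSr (subset_trans _ (IH _)) //.
exact/iter_spreadS/subsetUr.
Qed.

(* Replacing illegal choices by arbitrary unburnt vertices only enlarges the
   fire, and the process may stop early. *)
Lemma legal_burning B C s : B \subset C -> burnt e B s = setT ->
  exists s', [/\ size s' <= size s, burning_run e C s' & burnt e C s' = setT].
Proof.
elim: s B C => [|v s IH] B C sBC /=.
  by move=> BT; exists [::]; split=> //=; apply/eqP; rewrite -subTset -BT.
move=> burn; have [->|CnT] := eqVneq C setT; first by exists [::].
suff [w wP sw] : exists2 w, (w \notin spread C) || (spread C == setT)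
                          & v |: spread B \subset w |: spread C.
  have [s' [les run bs]] := IH _ _ sw burn.
  by exists (w :: s'); split; rewrite //= CnT wP.
have [vP|] := boolP ((v \notin spread C) || (spread C == setT)).
  by exists v; rewrite // setUS ?spreadS.
rewrite negb_or negbK -subTset => /andP[vC /subsetPn[w _ wC]].
exists w; first by rewrite wC.
by rewrite (subset_trans _ (subsetUr _ _)) // subUset sub1set vC spreadS.
Qed.

Lemma burning_number_leq s : burnt e set0 s = setT -> burning_number e <= size s.
Proof.
move=> /(legal_burning (subxx _))[s' [les run bs]].
rewrite /burning_number; case: ex_minnP => k _ /(_ (size s')) kmin.
apply: leq_trans les; apply: kmin; apply/existsP; exists (in_tuple s').
by rewrite run bs eqxx.
Qed.

(** * The tree of scattered centres *)

(* [p] is the parent map; [dep] forces [p root = root]. *)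
Definition is_tree A (root : T) p (dep : T -> nat) : Prop :=
  [/\ root \in A, dep root = 0,
      {in A, forall x, p x \in A},
      {in A, forall x, dep x = 0 -> x = root} &
      {in A, forall x, dep (p x) = (dep x).-1}].

Lemma scattered_tree d : symmetric e -> irreflexive e -> graph_connected e ->
  (forall x, d <= degree e x) -> 0 < #|T| ->
  exists A root p dep, [/\ is_tree A root p dep,
    {in A, forall x, x \in iter 3 spread [set p x]},
    d.+1 * #|A| <= #|T| & iter 2 spread A = setT].
Proof.
move=> e_sym e_irr e_conn e_deg /card_gt0P[root _].
have deg1 x : d.+1 <= #|spread [set x]| by rewrite card_spread1 // ltnS e_deg.
(* Induction on the bound in [#|T| < #|A|]: one centre is added per step, and a bound of [#|T|] is
   absurd, so the growth stops by covering everything. *)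
suff {e_deg} [A [p [dep [tA pA cA [AT|]]]]] : exists A p dep,
    [/\ is_tree A root p dep, {in A, forall x, x \in iter 3 spread [set p x]},
    d.+1 * #|A| <= #|spread A| & iter 2 spread A = setT \/ #|T| < #|A|].
- by exists A, root, p, dep; split=> //; apply: leq_trans cA (max_card _).
- by rewrite ltnNge max_card.
elim: #|T| => [|n [A [p [dep [tA pA cA AP]]]]].
  exists [set root], id, (fun=> 0); split; rewrite ?cards1 ?muln1 //.
  - by split=> [||x|x|x]; rewrite ?set11 // inE => /eqP.
  - move=> x _; apply: (subsetP (@iter_spread_leq 0 3 _ _)) => //.
    by rewrite /= set11.
  - by right.
case: AP => [AT|ltA]; first by exists A, p, dep; split=> //; left.
have [AT|AnT] := eqVneq (iter 2 spread A) setT.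
  by exists A, p, dep; split=> //; left.
have [rA dr0 pAA d0 dp] := tA.
(* Otherwise [iter 2 spread A] would be closed under [spread], hence everything by connectivity. *)
have [z zA3 zA2] : exists2 z, z \in iter 3 spread A & z \notin iter 2 spread A.
  apply/subsetPn; apply: contra AnT => cl; apply/eqP.
  apply: (spread_closed (x := root)) => //.
  exact: (subsetP (@iter_spread_leq 0 2 A _)).
have zA : z \notin A.
  by apply: contra zA2; apply: (subsetP (@iter_spread_leq 0 2 A _)).
have zN x : x \in A -> (x == z) = false.
  by move=> xA; apply/eqP => xz; rewrite -xz xA in zA.
have [a aA za] := in_iter_spread zA3.
exists (z |: A), (fun x => if x == z then a else p x),
  (fun x => if x == z then (dep a).+1 else dep x).
split.
- split=> [||x|x|x]; first by rewrite !inE rA orbT.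
  + by rewrite zN.
  + by rewrite !inE; case: eqP => [_ _|_ /= /pAA->]; rewrite ?aA orbT.
  + by rewrite !inE; case: eqP => // _; apply: d0.
  + by rewrite !inE; case: eqP => [_ _|_ /= xA]; rewrite zN ?pAA //= dp.
- by move=> x; rewrite in_setU1; case: eqP => [->//|_]; apply: pA.
- rewrite cardsU1 zA mulnDr muln1 spreadU.
  rewrite cardsU (_ : _ :&: _ = set0) ?cards0 ?subn0 ?leq_add //.
  (* A vertex [w] in both closed neighbourhoods would put [z] within distance 2 of [A]. *)
  apply/setP=> w; rewrite !in_setI in_set0; apply/negP => /andP[wz wA].
  case/negP: zA2; rewrite spread1_sym // in wz.
  by apply: subsetP wz; apply: spreadS; rewrite sub1set.
- by right; rewrite cardsU1 zA.
Qed.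

(* [a] is the [m]-th ancestor of a deepest element of [U], or the root if that
   element has depth at most [m]. *)
Lemma prune_tree A root p dep U m : is_tree A root p dep -> U \subset A ->
  {in U, forall x, p x \in U} -> U != set0 ->
  exists a D, [/\ {in D, forall y, exists2 j, j <= m & iter j p y = a},
    D \subset U, {in U :\: D, forall x, p x \in U :\: D} &
    m < #|D| \/ D = U].
Proof.
case=> rA dr0 pA d0 dp sUA pU /set0Pn[x0 x0U].
have [x xU xmax] : exists2 x, x \in U & {in U, forall y, dep y <= dep x}.
  by case: (arg_maxnP dep x0U) => x xU xmax; exists x.
have iU j y : y \in U -> iter j p y \in U by move=> yU; elim: j => //= j /pU.
have dpi j y : y \in U -> dep (iter j p y) = dep y - j.
  move=> yU; elim: j => [|j IH] /=; first by rewrite subn0.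
  by rewrite dp ?IH ?subnS // (subsetP sUA) ?iU.
have [lexm|ltmx] := leqP (dep x) m.
  exists root, U; split=> //; last by right.
    (* Depth truncates at 0 and only [root] has depth 0, so [m] parent steps lead every element of
       [U] to [root]. *)
    move=> y yU; exists m => //; apply: d0; first by rewrite (subsetP sUA) ?iU.
    by rewrite dpi //; apply/eqP; rewrite subn_eq0 (leq_trans _ lexm) ?xmax.
  by move=> y; rewrite setDv in_set0.
set a := iter m p x.
pose D := [set y in U | [exists j : 'I_m.+1, iter j p y == a]].
have inD y j : j <= m -> y \in U -> iter j p y = a -> y \in D.
  move=> ljm yU ija; rewrite inE yU; apply/existsP.
  by exists (Ordinal (ljm : j < m.+1)); apply/eqP.
have DP y : y \in D -> exists2 j, j <= m & iter j p y = a.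
  by rewrite inE => /andP[_ /existsP[j /eqP ja]]; exists j => //; rewrite -ltnS ltn_ord.
exists a, D; split=> //; first by apply/subsetP => y; rewrite inE => /andP[].
- move=> y /setDP[yU yD]; rewrite in_setD pU // andbT.
  apply: contra yD => /DP[j ljm]; rewrite -iterSr => ja.
  (* If [j = m], then [y] would lie deeper than [x]. *)
  apply: (inD y j.+1) => //; rewrite ltn_neqAle ljm andbT.
  apply/eqP => jm; move/(congr1 dep): ja; rewrite dpi // /a dpi //.
  by have := xmax y yU; lia.
(* The path from [x] up to [a] has [m.+1] elements, told apart by their depths. *)
- left; rewrite -[m.+1]card_ord; pose f (j : 'I_m.+1) := iter j p x.
  have injf : injective f.
    move=> i j /(congr1 dep); rewrite /f !dpi // => dij; apply/ord_inj.
    by have := ltn_ord i; have := ltn_ord j; lia.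
  rewrite -(card_imset _ injf); apply/subset_leq_card/subsetP => _ /imsetP[j _ ->].
  apply: (inD _ (m - j)); rewrite ?leq_subr ?iU // /f -iterD subnK //.
  by rewrite -ltnS ltn_ord.
Qed.

(** Induction on the remaining rounds [k]. [U] holds the centres still to be handled; the cells of
    the others are reached by the present fire in time. With [k.+1] rounds left, the next choice
    burns a ball of radius [k] and removes [k.+1 %/ 3] centres, or all of [U]. *)
Lemma greedy_burning A root p dep U B k : is_tree A root p dep ->
  {in A, forall x, x \in iter 3 spread [set p x]} -> iter 2 spread A = setT ->
  U \subset A -> {in U, forall x, p x \in U} ->
  iter 2 spread (A :\: U) \subset iter k spread B ->
  #|U| <= \sum_(r < k) r.+1 %/ 3 ->
  exists2 s, size s = k & burnt e B s = setT.
Proof.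
move=> tA pA AT; elim: k U B => [|k IH] U B sUA pU covU.
  rewrite big_ord0 leqn0 cards_eq0 => /eqP U0; exists [::] => //=.
  by apply/eqP; rewrite -subTset -AT -(setD0 A) -U0.
rewrite big_ord_recr /= => leU.
suff [a [D [covD sDU pUD leUD]]] : exists a D,
    [/\ iter 2 spread D \subset iter k spread [set a], D \subset U,
     {in U :\: D, forall x, p x \in U :\: D} &
     #|U :\: D| <= \sum_(r < k) r.+1 %/ 3].
  have [||s ss bs] := IH (U :\: D) (a |: spread B) _ pUD _ leUD.
  - by rewrite (subset_trans _ sUA) ?subsetDl.
  - rewrite setDDr iter_spreadU iter_spreadU -iterSr setUC.
    by apply: setUSS => //; apply: subset_trans covD; apply: iter_spreadS;
      apply: subsetIr.
  by exists (a :: s); rewrite /= ?ss.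
(* When nothing has to be removed, [root] serves as a dummy choice. *)
have D0 : #|U| <= \sum_(r < k) r.+1 %/ 3 -> exists a D,
    [/\ iter 2 spread D \subset iter k spread [set a], D \subset U,
     {in U :\: D, forall x, p x \in U :\: D} &
     #|U :\: D| <= \sum_(r < k) r.+1 %/ 3].
  move=> leU'; exists root, set0; rewrite setD0; split; rewrite ?sub0set //.
  by rewrite iter_spread0 sub0set.
have [U0|Un0] := eqVneq U set0; first by apply: D0; rewrite U0 cards0.
have [lek|ltk] := leqP k 1.
  by apply: D0; apply: leq_trans leU _; rewrite (@divn_small k.+1) ?addn0.
(* This is the largest [m] with [2 + 3 * m <= k]: 3 per tree edge and 2 for the cell. Moreover
   [m.+1 = k.+1 %/ 3]. *)
have [a [D [aD sDU pUD cD]]] := prune_tree ((k - 2) %/ 3) tA sUA pU Un0.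
exists a, D; split=> //; last first.
  have := cardsID D U; rewrite (setIidPr sDU).
  move: leU; set S := \sum_(r < k) _.
  case: cD => [|->]; last by rewrite setDv cards0.
  lia.
have ball j y : y \in A -> y \in iter (3 * j) spread [set iter j p y].
  case: tA => _ _ pAA _ _; elim: j y => [|j IHj] y yA; first by rewrite set11.
  rewrite mulnS iterD [iter j.+1 p y]iterSr; apply: subsetP (pA y yA).
  by apply: iter_spreadS; rewrite sub1set IHj ?pAA.
apply: subset_trans (_ : iter (2 + 3 * ((k - 2) %/ 3)) spread [set a] \subset _).
  rewrite iterD; apply: iter_spreadS; apply/subsetP => y yD.
  have [j ljm <-] := aD y yD; apply: (subsetP (iter_spread_leq _ _)); last first.
    by apply: ball; rewrite (subsetP sUA) ?(subsetP sDU).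
  by rewrite leq_mul2l ljm.
by apply: iter_spread_leq; lia.
Qed.

End Burning.

(** * Counting and the final bound *)

Lemma sum_div3_leq k : k * k <= 6 * (\sum_(r < k) r.+1 %/ 3) + k + 2.
Proof.
(* The residue term makes the bound an equality, so the induction closes in each class modulo 3. *)
suff : k * k <= 6 * (\sum_(r < k) r.+1 %/ 3) + k + 2 * (k %% 3 == 2) by lia.
elim: k => [|k]; first by rewrite big_ord0.
rewrite big_ord_recr /=; set S := \sum_(r < k) _; move: S => S IH.
have [q [i ltq kE]] : exists q, exists2 i, i < 3 & k = q * 3 + i.
  by exists (k %/ 3), (k %% 3); rewrite ?ltn_mod // -divn_eq.
by move: IH; subst k; case: i ltq => [|[|[|]]] //; nia.
Qed.

Lemma burning_number_min_degree (T : finType) (e : rel T) (d k : nat) :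
  symmetric e -> irreflexive e -> graph_connected e ->
  (forall x, d <= degree e x) -> 12 <= d -> #|T| <= k * k ->
  burning_number e <= k.
Proof.
move=> e_sym e_irr e_conn e_deg hd leTk; case: (posnP #|T|) => [T0|Tgt0].
  apply: leq_trans (_ : size (Nil T) <= k) => //.
  apply: burning_number_leq; apply/esym/eqP.
  by rewrite -cards_eq0 cardsT T0.
have [A [root [p [dep [tA pA cA AT]]]]] :=
  scattered_tree e_sym e_irr e_conn e_deg Tgt0.
have [||||s <- bs] := @greedy_burning _ e _ _ _ _ A set0 k tA pA AT.
- exact: subxx.
- by case: tA.
- by rewrite setDv !iter_spread0.
(* With [2 * k <= k * k + 1] this gives [k * k <= 12 * S + 5], so [13 * #|A| <= 12 * S + 5] and
   [#|A| <= S]. *)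
- have := sum_div3_leq k; set S := \sum_(r < k) _; move: S => S.
  have : 13 * #|A| <= k * k.
    by apply: leq_trans leTk; apply: leq_trans cA; rewrite leq_mul2r ltnS hd orbT.
  have : 2 * k <= k * k + 1 by nia.
  by move: (k * k) => K; lia.
exact: burning_number_leq.
Qed.

Theorem theorem6 (R : realType) (T : finType) (e : rel T)
  (e_sym : symmetric e) (e_irr : irreflexive e)
  (d : nat) (hd : 12 <= d)
  (e_conn : graph_connected e) (e_tf : triangle_free e)
  (e_deg : forall x : T, d <= degree e x) :
  well_burnable e R.
Proof.
rewrite /well_burnable; set c := Num.ceil _.
have c_ge : (Num.sqrt (#|T|%:R : R) <= c%:~R)%R by apply: ceil_ge.
have c0 : (0 <= c)%R.
  by rewrite -(ler0z R) (le_trans _ c_ge) ?sqrtr_ge0.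
(* The nonnegative ceiling is a natural number [k]; squaring [c_ge] gives [#|T| <= k * k]. *)
case: c c_ge c0 => // k c_ge _.
apply: (burning_number_min_degree e_sym e_irr e_conn e_deg hd).
rewrite -(ler_nat R) natrM -expr2 -(@sqr_sqrtr _ #|T|%:R) ?ler0n //.
by rewrite lerXn2r // nnegrE ?sqrtr_ge0 ?ler0n.
Qed.
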